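(* For every integer $n\ge 1$, the set $L_n$ of signed basis elements of the standard real Cayley-Dickson algebra $A_n$ of dimension $2^n$ is, under the multiplication of $A_n$, a flexible C-loop.
   Context: A C-loop is a loop satisfying $x(y\cdot yz) = (xy\cdot y)z$. A loop is flexible if it satisfies $x\cdot yx=xy\cdot x$. An algebra over a field $F$ is an $F$-vector space with a bilinear (not necessarily associative) multiplication with neutral element $1$. Given a finite-dimensional algebra $D$ over $F$ with a quadratic form $N_D:D\to F$, let $\langle x,y\rangle_D=N_D(x+y)-N_D(x)-N_D(y)$ and $\overline{x}=\langle x,1\rangle_D 1-x$. The pair $(C,N_C)$ is obtained from $(D,N_D)$ by standard doubling if $C=D\oplus D$ as a vector space, with multiplication $(x,y)(u,v)=(xu-\overline{v}y,\ vx+y\overline{u})$ and $N_C((x,y))=N_D(x)+N_D(y)$. Let $A_0=\mathbb{R}$ with $N(x)=x^2$, and let $A_{n+1}$ be obtained from $A_n$ by standard doubling; thus $\dim A_n=2^n$. The basis $\{a_1,\dots,a_{2^n}\}$ of $A_n$ is chosen recursively: for $n=0$, $a_1=1$; if $d_1,\dots,d_m$ ($m=2^n$) is the chosen basis of $A_n$, then the chosen basis $c_1,\dots,c_{2m}$ of $A_{n+1}$ is $c_i=(d_i,0)$, $c_{i+m}=(0,d_i)$ for $1\le i\le m$. Set $L_n=\{\pm a_1,\dots,\pm a_{2^n}\}$. *)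

(* Defs.v *)
From HB Require Import structures.
From mathcomp Require Import all_boot all_order all_algebra.
From mathcomp Require Import ring reals.

Set Implicit Arguments.
Unset Strict Implicit.
Unset Printing Implicit Defensive.

Import Order.TTheory GRing.Theory Num.Theory.
Local Open Scope ring_scope.

Section Loops.
Variables (T : eqType) (mul : T -> T -> T).

Definition is_loop (S : {pred T}) : Prop :=
  [/\ {in S &, forall x y, mul x y \in S},
      exists2 e, e \in S & {in S, forall x, mul e x = x /\ mul x e = x},
      {in S &, forall a b, exists! x, x \in S /\ mul a x = b}
    & {in S &, forall a b, exists! y, y \in S /\ mul y a = b}].

Definition is_C_loop (S : {pred T}) : Prop :=
  is_loop S /\
  {in S & &, forall x y z,
    mul x (mul y (mul y z)) = mul (mul (mul x y) y) z}.

Definition is_flexible (S : {pred T}) : Prop :=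
  {in S &, forall x y, mul x (mul y x) = mul (mul x y) x}.

End Loops.

Definition polar (F : fieldType) (D : lmodType F) (N : D -> F) (x y : D) : F :=
  N (x + y) - N x - N y.

(* Finite-dimensional, not necessarily associative, unital algebras with a
   quadratic form.  The normalisation N 1 = 1 makes conjugation fix 1, which is
   what (1, 0) needs in order to be neutral in the standard doubling. *)
Record quadAlg (F : fieldType) := QuadAlg {
  qa_sort :> vectType F;
  qa_one : qa_sort;
  qa_mul : qa_sort -> qa_sort -> qa_sort;
  qa_norm : qa_sort -> F;
  qa_mul_linear_r : forall x, linear (qa_mul x);
  qa_mul_linear_l : forall y, linear (qa_mul^~ y);
  qa_mul1x : left_id qa_one qa_mul;
  qa_mulx1 : right_id qa_one qa_mul;
  qa_normZ : forall a x, qa_norm (a *: x) = a ^+ 2 * qa_norm x;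
  qa_polar_linear : forall y, scalar ((polar qa_norm)^~ y);
  qa_norm1 : qa_norm qa_one = 1
}.

Definition qa_conj (F : fieldType) (D : quadAlg F) (x : D) : D :=
  polar (@qa_norm F D) x (qa_one D) *: qa_one D - x.

Section StandardDoubling.
Variables (F : fieldType) (D : quadAlg F).
Implicit Types x y : (D * D)%type.

Definition double_one : (D * D)%type := (qa_one D, 0).

Definition double_mul x y : (D * D)%type :=
  (qa_mul x.1 y.1 - qa_mul (qa_conj y.2) x.2,
   qa_mul y.2 x.1 + qa_mul x.2 (qa_conj y.1)).

Definition double_norm x : F := qa_norm x.1 + qa_norm x.2.

Let mul0x (z : D) : qa_mul 0 z = 0.
Proof.
have := qa_mul_linear_l z (-1) 0 0.
by rewrite scaler0 addr0 scaleN1r addNr.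
Qed.

Let mulx0 (z : D) : qa_mul z 0 = 0.
Proof.
have := qa_mul_linear_r z (-1) 0 0.
by rewrite scaler0 addr0 scaleN1r addNr.
Qed.

Let norm0 : qa_norm (0 : D) = 0.
Proof. by rewrite -(scale0r 0) qa_normZ expr0n mul0r. Qed.

Let conj_linear : linear (@qa_conj F D).
Proof.
move=> a u v; rewrite /qa_conj qa_polar_linear scalerDl opprD addrACA.
by rewrite scalerBr scalerA.
Qed.

Let conj0 : qa_conj (0 : D) = 0.
Proof.
have := conj_linear (-1) 0 0.
by rewrite scaler0 addr0 scaleN1r addNr.
Qed.

Let conj1 : qa_conj (qa_one D) = qa_one D.
Proof.
rewrite /qa_conj /polar; have -> : qa_one D + qa_one D = 2%:R *: qa_one D.
  by rewrite scaler_nat mulr2n.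
rewrite qa_normZ qa_norm1 mulr1 -[X in _ - X]scale1r -scalerBl.
rewrite -[RHS]scale1r; congr (_ *: _).
by ring.
Qed.

Lemma double_mul_linear_r x : linear (double_mul x).
Proof.
move=> a [u v] [u' v']; rewrite /double_mul /=.
congr (_, _); rewrite /= conj_linear qa_mul_linear_l qa_mul_linear_r.
  by rewrite opprD addrACA scalerBr.
by rewrite addrACA scalerDr.
Qed.

Lemma double_mul_linear_l y : linear (double_mul^~ y).
Proof.
move=> a [u v] [u' v']; rewrite /double_mul /=.
congr (_, _); rewrite /= qa_mul_linear_l qa_mul_linear_r.
  by rewrite opprD addrACA scalerBr.
by rewrite addrACA scalerDr.
Qed.

Lemma double_mul1x : left_id double_one double_mul.
Proof.
by case=> u v; rewrite /double_mul /= qa_mul1x qa_mulx1 mul0x mulx0 subr0 addr0.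
Qed.

Lemma double_mulx1 : right_id double_one double_mul.
Proof.
case=> u v.
by rewrite /double_mul /= qa_mulx1 conj0 conj1 qa_mulx1 !mul0x subr0 add0r.
Qed.

Lemma double_normZ a x : double_norm (a *: x) = a ^+ 2 * double_norm x.
Proof. by rewrite /double_norm /= !qa_normZ mulrDr. Qed.

Lemma double_polar_linear y : scalar ((polar double_norm)^~ y).
Proof.
have polarE x : polar double_norm x y =
    polar (@qa_norm F D) x.1 y.1 + polar (@qa_norm F D) x.2 y.2.
  by rewrite /polar /double_norm /=; ring.
by move=> a u v; rewrite !polarE !qa_polar_linear /=; ring.
Qed.

Lemma double_norm1 : double_norm double_one = 1.
Proof. by rewrite /double_norm /= qa_norm1 norm0 addr0. Qed.

Definition double : quadAlg F :=
  @QuadAlg F (D * D)%type double_one double_mul double_norm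
    double_mul_linear_r double_mul_linear_l double_mul1x double_mulx1
    double_normZ double_polar_linear double_norm1.

End StandardDoubling.

Section BaseAlgebra.
Variable F : fieldType.

Definition base_norm (x : F^o) : F := x ^+ 2.

Lemma base_mul_linear_r (x : F^o) : linear ( *%R x : F^o -> F^o).
Proof. by move=> a u v; rewrite mulrDr -scalerAr. Qed.

Lemma base_mul_linear_l (y : F^o) : linear (( *%R^~ y) : F^o -> F^o).
Proof. by move=> a u v; rewrite mulrDl -scalerAl. Qed.

Lemma base_normZ a (x : F^o) : base_norm (a *: x) = a ^+ 2 * base_norm x.
Proof. exact: exprMn. Qed.

Lemma base_polar_linear (y : F^o) : scalar ((polar base_norm)^~ y).
Proof.
have polarE x : polar base_norm x y = (x * y) *+ 2.
  by rewrite /polar /base_norm; ring.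
move=> a u v; rewrite !polarE (_ : a *: u = a * u) //=; ring.
Qed.

Definition base_alg : quadAlg F :=
  @QuadAlg F F^o 1 *%R base_norm base_mul_linear_r base_mul_linear_l
    (@mul1r F) (@mulr1 F) base_normZ base_polar_linear (expr1n F 2).

End BaseAlgebra.

Fixpoint cayley_dickson (R : realType) (n : nat) : quadAlg R :=
  if n is m.+1 then double (cayley_dickson R m) else base_alg R.

Fixpoint cd_basis (R : realType) (n : nat) : seq (cayley_dickson R n) :=
  if n is m.+1 then
    [seq (d, 0) | d <- cd_basis R m] ++ [seq (0, d) | d <- cd_basis R m]
  else [:: 1].

Definition cd_loop (R : realType) (n : nat) : seq (cayley_dickson R n) :=
  cd_basis R n ++ [seq - a | a <- cd_basis R n].

Lemma size_cd_basis (R : realType) n : size (cd_basis R n) = (2 ^ n)%N.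
Proof.
by elim: n => //= n IHn; rewrite size_cat !size_map IHn expnS mul2n addnn.
Qed.

Lemma dim_cayley_dickson (R : realType) n :
  \dim {:cayley_dickson R n} = (2 ^ n)%N.
Proof.
rewrite dimvf; elim: n => //= n IHn.
change (dim (cayley_dickson R n) + dim (cayley_dickson R n) = 2 ^ n.+1)%N.
by rewrite IHn expnS mul2n addnn.
Qed.

Lemma cd_basis_span_ind (R : realType) n (P : cayley_dickson R n -> Prop) :
    P 0 -> (forall a u v, P u -> P v -> P (a *: u + v)) ->
  {in cd_basis R n, forall b, P b} -> forall x, P x.
Proof.
elim: n P => [|n IHn] P P0 PD PB x.
  have := PD x 1 0 (PB 1 (mem_head _ _)) P0.
  by rewrite addr0 (_ : x *: 1 = x) //; exact: mulr1.
have inl0 : forall d, P (d, 0).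
  apply: (IHn (fun d => P (d, 0))) => // [a u v Pu Pv|b Bb].
    by have := PD a _ _ Pu Pv; congr P; congr (_, _); rewrite /= scaler0 addr0.
  by apply: PB; rewrite /= mem_cat map_f.
have inr0 : forall d, P (0, d).
  apply: (IHn (fun d => P (0, d))) => // [a u v Pu Pv|b Bb].
    by have := PD a _ _ Pu Pv; congr P; congr (_, _); rewrite /= scaler0 addr0.
  by apply: PB; rewrite /= mem_cat orbC map_f.
case: x => d e; have := PD 1 _ _ (inl0 d) (inr0 e).
by congr P; congr (_, _); rewrite /= scale1r ?addr0 ?add0r.
Qed.

Lemma cd_basisP (R : realType) n :
  basis_of {:cayley_dickson R n} (cd_basis R n).
Proof.
rewrite basisEdim size_cd_basis dim_cayley_dickson leqnn andbT.
apply/subvP => x _; move: x; apply: cd_basis_span_ind.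
- exact: mem0v.
- by move=> a u v Uu Uv; rewrite rpredD ?rpredZ.
- exact: memv_span.
Qed.

(* Main.v *)
(** Let [conj] be the conjugation of the algebra. It is an involutive
    anti-automorphism, it maps every signed basis element to itself up to sign,
    and by induction along the doubling [conj x * (x * y) = y] on signed basis
    elements. Applying [conj] gives [(y * x) * conj x = y], so [x * x = s] with
    [s = 1] or [s = -1], and [x * (x * y) = s y = (y * x) * x]: hence divisions,
    and both sides of the C-identity equal [s (x * z)]. Since [x], [y] and
    [x * y] are fixed up to sign by [conj], [x * y] and [y * x] agree up to sign;
    this gives flexibility. *)
From HB Require Import structures.
Require Import Defs.
From mathcomp Require Import all_boot all_order all_algebra.
From mathcomp Require Import reals.

Set Implicit Arguments.
Unset Strict Implicit.
Unset Printing Implicit Defensive.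

Import GRing.Theory.
Local Open Scope ring_scope.

(** * Linearity and conjugation in a quadratic algebra *)

Section QuadAlgTheory.
Variables (F : fieldType) (D : quadAlg F).
Implicit Types x y z : D.

HB.instance Definition _ x :=
  GRing.isLinear.Build F D D *:%R (qa_mul x) (qa_mul_linear_r x).

Lemma qa_mulx0 x : qa_mul x 0 = 0.
Proof. exact: linear0. Qed.

Lemma qa_mulxN x y : qa_mul x (- y) = - qa_mul x y.
Proof. exact: linearN. Qed.

Lemma qa_mul0x x : qa_mul 0 x = 0.
Proof.
have := qa_mul_linear_l x (-1) 0 0.
by rewrite scaler0 addr0 scaleN1r addNr.
Qed.

Lemma qa_mulNx x y : qa_mul (- x) y = - qa_mul x y.
Proof.
have := qa_mul_linear_l y (-1) x 0.
by rewrite /= qa_mul0x !addr0 !scaleN1r.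
Qed.

Lemma qa_norm0 : qa_norm (0 : D) = 0.
Proof. by rewrite -(scale0r 0) qa_normZ expr0n mul0r. Qed.

Lemma qa_conj_linear : linear (@qa_conj F D).
Proof.
move=> a u v; rewrite /qa_conj qa_polar_linear scalerDl opprD addrACA.
by rewrite scalerBr scalerA.
Qed.

HB.instance Definition _ :=
  GRing.isLinear.Build F D D *:%R (@qa_conj F D) qa_conj_linear.

Lemma qa_conj0 : qa_conj (0 : D) = 0.
Proof. exact: linear0. Qed.

Lemma qa_conjN x : qa_conj (- x) = - qa_conj x.
Proof. exact: linearN. Qed.

Lemma qa_conjB x y : qa_conj (x - y) = qa_conj x - qa_conj y.
Proof. exact: linearB. Qed.

(** As [1 + 1] has norm 4 and [1] has norm 1, the polar form at [(1, 1)] is 2. *)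
Lemma qa_conj1 : qa_conj (qa_one D) = qa_one D.
Proof.
rewrite /qa_conj /polar -{1 2}[qa_one D]scale1r -scalerDl qa_normZ qa_norm1.
rewrite mulr1 -{2}[qa_one D]scale1r -scalerBl -[RHS]scale1r; congr (_ *: _).
by rewrite expr2 mulrDl mul1r !addrA !addrK.
Qed.

Lemma qa_conjK : involutive (@qa_conj F D).
Proof.
move=> x; rewrite {2}/qa_conj linearB linearZ /= qa_conj1 /qa_conj.
by rewrite opprB addrCA subrr addr0.
Qed.

End QuadAlgTheory.

(** * Conjugation in a standard double *)

Section Doubling.
Variables (F : fieldType) (D : quadAlg F).

(** The neutral element is [(1, 0)], so the norm of [y] cancels in the polar form. *)
Lemma double_conjE (x y : D) :
  qa_conj ((x, y) : Defs.double D) = (qa_conj x, - y).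
Proof.
rewrite /qa_conj /polar /= /double_norm /= addr0 qa_norm0 addr0.
congr (_, _); rewrite /= ?scaler0 ?sub0r //; congr (_ *: _ - _).
by rewrite opprD addrACA subrr addr0.
Qed.

Lemma double_mulE (x y u v : D) :
  qa_mul ((x, y) : Defs.double D) (u, v) =
  (qa_mul x u - qa_mul (qa_conj v) y, qa_mul v x + qa_mul y (qa_conj u)).
Proof. by []. Qed.

Lemma double_conjM :
    (forall x y : D, qa_conj (qa_mul x y) = qa_mul (qa_conj y) (qa_conj x)) ->
  forall x y : Defs.double D,
    qa_conj (qa_mul x y) = qa_mul (qa_conj y) (qa_conj x).
Proof.
move=> conjM [x y] [u v].
rewrite double_mulE !double_conjE double_mulE; congr (_, _).
  by rewrite qa_conjB !conjM qa_conjK qa_conjN qa_mulNx qa_mulxN opprK.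
by rewrite opprD qa_conjK !qa_mulNx addrC.
Qed.

End Doubling.

(** * Signed basis elements: conjugation and closure *)

Section CayleyDickson.
Variable R : realType.

Lemma cd_conjM n (x y : cayley_dickson R n) :
  qa_conj (qa_mul x y) = qa_mul (qa_conj y) (qa_conj x).
Proof.
elim: n x y => [|n IHn] x y; last exact: double_conjM.
(* The base algebra is spanned by [1], which the linear map [qa_conj] fixes; commutativity of the
   field then suffices. *)
have conjE (a : base_alg R) : qa_conj a = a.
  rewrite -{1}[a](qa_mulx1 a) (_ : qa_mul a _ = a *: qa_one (base_alg R)) //.
  by rewrite linearZ /= qa_conj1 -[RHS]qa_mulx1.
by rewrite !conjE; exact: mulrC.
Qed.

Lemma cd_loop0P (x : cayley_dickson R 0) : x \in cd_loop R 0 ->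
  x = qa_one (cayley_dickson R 0) \/ x = - qa_one (cayley_dickson R 0).
Proof. by rewrite !inE => /orP[] /eqP->; [left | right]. Qed.

Lemma mem_cd_loopN n (x : cayley_dickson R n) :
  x \in cd_loop R n -> - x \in cd_loop R n.
Proof.
rewrite !mem_cat => /orP[Bx|/mapP[a Ba ->]]; last by rewrite opprK Ba.
by apply/orP; right; apply: map_f.
Qed.

Lemma cd_loop_inl n (d : cayley_dickson R n) :
  d \in cd_loop R n -> ((d, 0) : cayley_dickson R n.+1) \in cd_loop R n.+1.
Proof.
have inlB b : b \in cd_basis R n ->
    ((b, 0) : cayley_dickson R n.+1) \in cd_loop R n.+1.
  by move=> Bb; rewrite !mem_cat map_f.
rewrite mem_cat => /orP[/inlB //|/mapP[b /inlB /mem_cd_loopN Lb ->]].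
by rewrite (_ : (- b, 0) = - ((b, 0) : Defs.double _)) //; congr pair; rewrite oppr0.
Qed.

Lemma cd_loop_inr n (d : cayley_dickson R n) :
  d \in cd_loop R n -> ((0, d) : cayley_dickson R n.+1) \in cd_loop R n.+1.
Proof.
have inrB b : b \in cd_basis R n ->
    ((0, b) : cayley_dickson R n.+1) \in cd_loop R n.+1.
  move=> Bb; rewrite mem_cat [_ \in cd_basis R n.+1]mem_cat.
  by apply/orP; left; apply/orP; right; exact: map_f.
rewrite mem_cat => /orP[/inrB //|/mapP[b /inrB /mem_cd_loopN Lb ->]].
by rewrite (_ : (0, - b) = - ((0, b) : Defs.double _)) //; congr pair; rewrite oppr0.
Qed.

(** Absorbing the sign into [d] leaves only four cases for a pair of elements in the inductions
    below. *)
Lemma cd_loopSP n (z : cayley_dickson R n.+1) : z \in cd_loop R n.+1 ->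
  exists2 d, d \in cd_loop R n & z = (d, 0) \/ z = (0, d).
Proof.
have basisP b : b \in cd_basis R n.+1 ->
    exists2 d, d \in cd_loop R n & b = (d, 0) \/ b = (0, d).
  rewrite mem_cat => /orP[] /mapP[d Bd ->]; exists d.
  - by rewrite mem_cat Bd.
  - by left.
  - by rewrite mem_cat Bd.
  - by right.
rewrite mem_cat => /orP[/basisP //|/mapP[b /basisP[d Ld bE] ->]].
exists (- d); first exact: mem_cd_loopN.
by case: bE => ->; [left | right]; congr pair; rewrite oppr0.
Qed.

Lemma cd_loop1 n : qa_one (cayley_dickson R n) \in cd_loop R n.
Proof.
by elim: n => [|n IHn]; [exact: mem_head | exact: cd_loop_inl].
Qed.

(** Conjugation negates the second component of a double, so only elements [(d, 0)] call on the
    induction hypothesis. *)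
Lemma cd_loop_conj_sign n (x : cayley_dickson R n) :
  x \in cd_loop R n -> qa_conj x = x \/ qa_conj x = - x.
Proof.
elim: n x => [|n IHn] x.
  by move=> /cd_loop0P[] ->; left; rewrite ?qa_conjN qa_conj1.
move=> /cd_loopSP[d Ld [->|->]]; rewrite double_conjE.
  by rewrite oppr0; case: (IHn d Ld) => ->; [left | right] => //;
     congr pair; rewrite oppr0.
by right; rewrite qa_conj0; congr pair; rewrite oppr0.
Qed.

Lemma cd_loop_conj n (x : cayley_dickson R n) :
  x \in cd_loop R n -> qa_conj x \in cd_loop R n.
Proof.
by move=> Lx; case: (cd_loop_conj_sign Lx) => -> //; exact: mem_cd_loopN.
Qed.

Lemma cd_loopM n (x y : cayley_dickson R n) :
  x \in cd_loop R n -> y \in cd_loop R n -> qa_mul x y \in cd_loop R n.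
Proof.
elim: n x y => [|n IHn] x y.
  have [L1 LN1] := (cd_loop1 0, mem_cd_loopN (cd_loop1 0)).
  by move=> /cd_loop0P[] -> /cd_loop0P[] ->;
    rewrite ?(qa_mulNx, qa_mulxN, opprK) qa_mul1x.
move=> /cd_loopSP[a La [->|->]] /cd_loopSP[b Lb [->|->]]; rewrite double_mulE;
  rewrite ?qa_conj0 ?qa_mul0x ?qa_mulx0 ?oppr0 ?add0r ?addr0.
- exact/cd_loop_inl/IHn.
- exact/cd_loop_inr/IHn.
- by apply/cd_loop_inr/IHn => //; exact: cd_loop_conj.
- by apply/cd_loop_inl/mem_cd_loopN/IHn => //; exact: cd_loop_conj.
Qed.

(** * Cancellation laws, signs and the loop axioms *)

Lemma cd_mulKV_of_mulVK n :
    {in cd_loop R n &, forall x y, qa_mul (qa_conj x) (qa_mul x y) = y} ->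
  {in cd_loop R n &, forall x y, qa_mul (qa_mul y x) (qa_conj x) = y}.
Proof.
(* Conjugation turns the goal into the left law at [qa_conj x] and [qa_conj y]. *)
move=> mulVK x y Lx Ly; apply: (can_inj (@qa_conjK _ _)); rewrite !cd_conjM.
by apply: mulVK; exact: cd_loop_conj.
Qed.

Lemma cd_mulVK n :
  {in cd_loop R n &, forall x y, qa_mul (qa_conj x) (qa_mul x y) = y}.
Proof.
elim: n => [|n IHn] x y.
  by move=> /cd_loop0P[] -> _; rewrite ?qa_conjN qa_conj1;
    rewrite ?(qa_mulNx, qa_mulxN, opprK) !qa_mul1x.
have mulKV := cd_mulKV_of_mulVK IHn.
have IHn' : {in cd_loop R n &, forall a b, qa_mul a (qa_mul (qa_conj a) b) = b}.
  by move=> a b La Lb; rewrite -{1}[a]qa_conjK IHn ?cd_loop_conj.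
have mulKV' : {in cd_loop R n &, forall a b, qa_mul (qa_mul b (qa_conj a)) a = b}.
  by move=> a b La Lb; rewrite -{2}[a]qa_conjK mulKV ?cd_loop_conj.
(* One component survives in each case, namely [a'(ab)], [(ba)a'], [(ba')a] and [a(a'b)] in turn,
   with [a'] the conjugate of [a]: one law for each. *)
move=> /cd_loopSP[a La [->|->]] /cd_loopSP[b Lb [->|->]];
  rewrite double_conjE !double_mulE;
  rewrite ?(qa_conj0, qa_mul0x, qa_mulx0, oppr0, add0r, addr0);
  rewrite ?(qa_conjN, qa_mulNx, qa_mulxN, opprK) ?(cd_conjM, qa_conjK).
- by rewrite IHn.
- by rewrite mulKV.
- by rewrite mulKV'.
- by rewrite IHn'.
Qed.

Definition cd_mulKV n := cd_mulKV_of_mulVK (@cd_mulVK n).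

(** Replace [qa_conj x] by [x] or [- x] in both cancellation laws. The sign is chosen before [y], so
    the C-identity can use it for two different elements. *)
Lemma cd_loop_square n (x : cayley_dickson R n) : x \in cd_loop R n ->
    {in cd_loop R n, forall y,
      qa_mul x (qa_mul x y) = y /\ qa_mul (qa_mul y x) x = y} \/
    {in cd_loop R n, forall y,
      qa_mul x (qa_mul x y) = - y /\ qa_mul (qa_mul y x) x = - y}.
Proof.
move=> Lx; case: (cd_loop_conj_sign Lx) => xE; [left | right] => y Ly;
  have := cd_mulKV Lx Ly; have := cd_mulVK Lx Ly; rewrite xE // qa_mulNx qa_mulxN.
by move=> /(canRL (@opprK _)) -> /(canRL (@opprK _)) ->.
Qed.

Lemma cd_loop_comm_sign n (x y : cayley_dickson R n) :
    x \in cd_loop R n -> y \in cd_loop R n ->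
  qa_mul x y = qa_mul y x \/ qa_mul x y = - qa_mul y x.
Proof.
move=> Lx Ly; have := cd_conjM x y.
by case: (cd_loop_conj_sign (cd_loopM Lx Ly)) => ->;
  case: (cd_loop_conj_sign Lx) => ->; case: (cd_loop_conj_sign Ly) => ->;
  rewrite ?(qa_mulNx, qa_mulxN, opprK) => E;
  (* The eight sign choices leave [E] in four shapes: a sign or none on either side. *)
  by [left | right | left; exact: oppr_inj E | right; rewrite -E opprK].
Qed.

(** Multiplying by [qa_conj a] gives the quotients: the cancellation laws at [qa_conj a] show
    existence, those at [a] uniqueness. *)
Lemma cd_loop_is_loop n :
  is_loop (@qa_mul R (cayley_dickson R n)) (mem (cd_loop R n)).
Proof.
split.
- exact: cd_loopM.
- exists (qa_one (cayley_dickson R n)); first exact: cd_loop1.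
  by move=> x _; rewrite qa_mul1x qa_mulx1.
- move=> a b La Lb; exists (qa_mul (qa_conj a) b); split.
    split; first by apply: cd_loopM => //; exact: cd_loop_conj.
    by rewrite -{1}[a]qa_conjK cd_mulVK ?cd_loop_conj.
  by move=> x [Lx <-]; exact: cd_mulVK.
- move=> a b La Lb; exists (qa_mul b (qa_conj a)); split.
    split; first by apply: cd_loopM => //; exact: cd_loop_conj.
    by rewrite -{2}[a]qa_conjK cd_mulKV ?cd_loop_conj.
  by move=> x [Lx <-]; exact: cd_mulKV.
Qed.

End CayleyDickson.

Theorem proposition7p1 (R : realType) (n : nat) (hn : (1 <= n)%N) :
  is_C_loop (@qa_mul R (cayley_dickson R n)) (mem (cd_loop R n)) /\
  is_flexible (@qa_mul R (cayley_dickson R n)) (mem (cd_loop R n)).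
Proof.
split.
  split; first exact: cd_loop_is_loop.
  move=> x y z Lx Ly Lz.
  by case: (cd_loop_square Ly) => sqy;
    rewrite (sqy z Lz).1 (sqy x Lx).2 // qa_mulxN qa_mulNx.
move=> x y Lx Ly.
case: (cd_loop_comm_sign Lx Ly) => xyE; have := cd_loop_square Lx.
  by case=> /(_ y Ly) []; rewrite xyE => -> ->.
(* In the anticommuting case both sides change sign, to [- x(xy)] and [- (yx)x], which
   [cd_loop_square] equates. *)
rewrite xyE qa_mulNx -[in LHS](opprK (qa_mul y x)) -xyE qa_mulxN.
by case=> /(_ y Ly) [-> ->].
Qed.
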